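(* Let $K\subseteq\mathbb{R}^n$ be nonempty, closed and convex, let $f=(f_1,\dots,f_m):K\to\mathbb{R}^m$ be continuous, and let $f_1,\dots,f_m$ be convex over $K$. Assume that $\Theta_1$ has bounded values, i.e. $\Theta_1(\xi)$ is bounded for every $\xi\in\operatorname{dom}\Theta_1$. Then the weak Pareto solution set $\operatorname{Sol}^w(K,f)$ is unbounded if and only if $\operatorname{dom}\Theta_1$ is non-closed in $\Delta$.
   Context: $\Delta=\{(\xi_1,\dots,\xi_m)\in\mathbb{R}^m_+:\xi_1+\dots+\xi_m=1\}$. For $\xi\in\Delta$, $f_\xi=\xi_1f_1+\dots+\xi_mf_m$, and $\Theta_1(\xi)$ is the set of global minimizers of $f_\xi$ over $K$. $\operatorname{dom}\Theta_1=\{\xi\in\Delta:\Theta_1(\xi)\neq\emptyset\}$. A point $x\in K$ is a weak Pareto solution (an element of $\operatorname{Sol}^w(K,f)$) if there is no $y\in K$ with $f(y)-f(x)\in-\operatorname{int}\mathbb{R}^m_+$. *)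

(* Defs.v *)
From HB Require Import structures.
From mathcomp Require Import all_boot all_order all_algebra.
From mathcomp Require Import all_classical all_reals all_analysis.

Set Implicit Arguments.
Unset Strict Implicit.
Unset Printing Implicit Defensive.

Import Order.TTheory GRing.Theory Num.Theory.
Import numFieldNormedType.Exports.

Local Open Scope classical_set_scope.
Local Open Scope ring_scope.

(* R^n is the row-vector space 'rV[R]_n.  Its library norm is the sup norm,
   which gives the usual topology and the usual bounded sets.  A map K -> R^m is
   a total function on R^n; the definitions below only use its values on K. *)

Definition orthant (R : realType) (m : nat) : set 'rV[R]_m :=
  [set v | forall i, 0 <= v ord0 i].

Definition Delta (R : realType) (m : nat) : set 'rV[R]_m :=
  [set xi | orthant xi /\ \sum_(i < m) xi ord0 i = 1].

Definition weighted_sum (R : realType) (n m : nat) (f : 'rV[R]_n -> 'rV[R]_m)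
    (xi : 'rV[R]_m) (x : 'rV[R]_n) : R :=
  \sum_(i < m) xi ord0 i * f x ord0 i.

Definition Theta1 (R : realType) (n m : nat) (K : set 'rV[R]_n)
    (f : 'rV[R]_n -> 'rV[R]_m) (xi : 'rV[R]_m) : set 'rV[R]_n :=
  [set x | K x /\
           forall y, K y -> weighted_sum f xi x <= weighted_sum f xi y].

Definition dom_Theta1 (R : realType) (n m : nat) (K : set 'rV[R]_n)
    (f : 'rV[R]_n -> 'rV[R]_m) : set 'rV[R]_m :=
  [set xi | Delta xi /\ Theta1 K f xi !=set0].

Definition Solw (R : realType) (n m : nat) (K : set 'rV[R]_n)
    (f : 'rV[R]_n -> 'rV[R]_m) : set 'rV[R]_n :=
  [set x | K x /\
           ~ exists2 y, K y & (-%R @` (@orthant R m)°) (f y - f x)].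

(* Closedness of D in the relative topology of A; meant for D `<=` A, since
   subspace A makes every point outside A isolated. *)
Definition closed_in (T : topologicalType) (A D : set T) : Prop :=
  closed (D : set (subspace A)).

(* Main.v *)
Require Import Defs.
From mathcomp Require Import all_boot all_order all_algebra.
From mathcomp Require Import all_classical all_reals all_analysis.
From mathcomp Require Import ring lra.

(** Two facts carry the theorem, and both directions are then compactness
    arguments.

    The first is scalarization: the weak Pareto set is the union of the sets
    [Theta1 K f xi] over [xi] in the simplex.  A minimizer of a weighted sum
    cannot be improved in all coordinates at once ([Theta1_sub_Solw]).
    Conversely, if [x] is a weak Pareto solution then the convex functions
    [f_i - f_i x] are never simultaneously negative, and a theorem of the
    alternative for convex functions ([convex_alternative]) gives weights for
    which their combination is nonnegative on [K] ([Solw_Theta1]).  The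
    alternative is proved by induction on the number of functions from the case
    of two ([convex_alternative2]), where the weight is an infimum of ratios;
    this needs the order completeness of the reals but no separation theorem.

    The second is that a strict inequality [f_xi y < f_xi x] persists when [xi]
    and [x], the latter within [K], move a little ([near_weighted_sum_lt]).

    If the weak Pareto set is bounded, all minimizers lie in one compact part
    [B] of [K].  When [f_xi] has no minimizer, each [x] in [B] is beaten by some
    point of [K]; the strict inequality persists near [x] and [xi], so by
    compactness of [B] no weight near [xi] has a minimizer.  Hence the domain of
    [Theta1] is closed in the simplex ([closed_dom_Theta1]).

    If the domain is closed in the simplex, it is compact, so it is enough to
    bound [Theta1] locally uniformly on it ([near_Theta1_bounded]).  Take [x0]
    minimizing [f_xi] and a sphere around [x0] enclosing the bounded set
    [Theta1 K f xi].  On the part of the sphere in [K], [f_xi] exceeds its value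
    at [x0]; by compactness the same strict inequality holds for every weight
    [xi'] near [xi].  By convexity a minimizer of [f_xi'] outside the sphere
    would produce, where the segment to [x0] crosses the sphere, a value at most
    [f_xi' x0], which is impossible ([Theta1_ball]).  Scalarization then bounds
    the whole weak Pareto set ([bounded_Solw]). *)

Import Order.TTheory GRing.Theory Num.Theory.
Import numFieldNormedType.Exports.

Local Open Scope classical_set_scope.
Local Open Scope ring_scope.

Set Implicit Arguments.
Unset Strict Implicit.
Unset Printing Implicit Defensive.

(** * A theorem of the alternative for convex functions *)

Lemma convex_set_comb (R : realType) (E : lmodType R) (A : set E) x y (t : R) :
  convex_set A -> A x -> A y -> 0 <= t <= 1 -> A (t *: x + (1 - t) *: y).
Proof.
move=> cA Ax Ay /andP[t0 t1].
by have := cA x y (Itv01 t0 t1); rewrite !inE; apply.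
Qed.

Lemma convex_function_comb (R : realType) (E : lmodType R) (A : set E) (f : E -> R)
    x y (t : R) :
  convex_function A f -> A x -> A y -> 0 <= t <= 1 ->
  f (t *: x + (1 - t) *: y) <= t * f x + (1 - t) * f y.
Proof.
move=> cf Ax Ay /andP[t0 t1].
by have := cf (Itv01 t0 t1) x y; rewrite !inE; apply.
Qed.

Lemma convex_function_sum (R : realType) (E : lmodType R) (A : set E)
    (m : nat) (c : 'I_m -> R) (g : 'I_m -> E -> R) :
  (forall i, 0 <= c i) -> (forall i, convex_function A (g i)) ->
  convex_function A (fun x => \sum_(i < m) c i * g i x).
Proof.
move=> c0 cg t x y xA yA; rewrite convRE !mulr_sumr -big_split/=.
apply: ler_sum => i _; apply: le_trans (ler_wpM2l (c0 i) (cg i t x y xA yA)) _.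
rewrite convRE; lra.
Qed.

Lemma convex_set_sublevel (R : realType) (E : lmodType R) (A : set E)
    (g : E -> R) :
  convex_set A -> convex_function A g ->
  convex_set [set x | A x /\ g x < 0].
Proof.
move=> cA cg; apply/convex_setW => x y; rewrite !inE => -[Ax gx] [Ay gy] k k0 k1.
rewrite inE; split; first by have := cA x y k; rewrite !inE; apply.
have := cg k x y; rewrite !inE => /(_ Ax Ay)/le_lt_trans; apply.
rewrite convRE /= /unstable.onem; nra.
Qed.

(** With [a] ranging over the points of [A] where [g] is negative, a multiplier
    [mu] makes [h + mu * g] nonnegative on these points exactly when it is at
    most every ratio [h a / - g a].  The infimum of the ratios still works where
    [h] is negative: a failure there would give a point of the segment to some
    [a] at which both functions are negative.  Normalizing [mu] yields [t]. *)
Lemma convex_alternative2 (R : realType) (E : lmodType R) (A : set E)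
    (g h : E -> R) :
  convex_set A -> convex_function A g -> convex_function A h ->
  (forall x, A x -> g x < 0 -> 0 <= h x) ->
  exists2 t, 0 <= t <= 1 & forall x, A x -> 0 <= (1 - t) * g x + t * h x.
Proof.
move=> cA cg ch gh.
have [[a0 [Aa0 ga0]]|noneg] := pselect (exists a, A a /\ g a < 0); last first.
  exists 0; first by rewrite lexx ler01.
  move=> x Ax; rewrite subr0 mul1r mul0r addr0 leNgt; apply/negP => gx.
  by apply: noneg; exists x.
(* The segment from [b] to [a] would contain a point where [g] and [h] are
   both negative if the inequality failed. *)
have cross a b : A a -> g a < 0 -> A b -> h b < 0 ->
    - h b <= h a / - g a * g b.
  move=> Aa ga Ab hb.
  have ha := gh _ Aa ga.
  have gb : 0 <= g b by rewrite leNgt; apply/negP => /(gh _ Ab); rewrite leNgt hb.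
  rewrite mulrAC ler_pdivlMr ?oppr_gt0// leNgt; apply/negP => D.
  (* The weights [g b] on [a] and [- g a] on [b] cancel [g] and make [h]
     negative; adding [d] to the weight on [a] makes [g] negative as well,
     and [d] is small enough for [h] to stay negative. *)
  pose d := (h b * g a - h a * g b) / (h a + 1).
  have h1 : 0 < h a + 1 by lra.
  have d0 : 0 < d by rewrite divr_gt0//; nra.
  have dE : d * h a < h b * g a - h a * g b.
    have : d * (h a + 1) = h b * g a - h a * g b by rewrite divfK// gt_eqF.
    lra.
  pose s := (g b + d) - g a.
  have s0 : 0 < s by rewrite /s; lra.
  pose t := (g b + d) / s.
  have t01 : 0 <= t <= 1.
    by rewrite ler_pdivlMr// ler_pdivrMr// mul0r mul1r /s; lra.
  have tE : s * t = g b + d by rewrite mulrC divfK// gt_eqF.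
  have sg : s * (t * g a + (1 - t) * g b) < 0.
    have -> : s * (t * g a + (1 - t) * g b)
      = (s * t) * g a + (s - s * t) * g b by ring.
    rewrite tE /s; nra.
  have sh : s * (t * h a + (1 - t) * h b) < 0.
    have -> : s * (t * h a + (1 - t) * h b)
      = (s * t) * h a + (s - s * t) * h b by ring.
    rewrite tE /s; nra.
  rewrite !pmulr_rlt0// in sg sh.
  have := gh _ (convex_set_comb cA Aa Ab t01)
    (le_lt_trans (convex_function_comb cg Aa Ab t01) sg).
  rewrite leNgt => /negP; apply.
  exact: le_lt_trans (convex_function_comb ch Aa Ab t01) sh.
pose Q := [set h a / - g a | a in [set a | A a /\ g a < 0]].
have Q0 : Q !=set0 by exists (h a0 / - g a0), a0.
have Q_ge0 : lbound Q 0.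
  by move=> _ [a [Aa ga] <-]; rewrite divr_ge0 ?gh// oppr_ge0 ltW.
have Q_inf : has_inf Q by split=> //; exists 0.
have mu0 : 0 <= inf Q by apply: lb_le_inf.
have key x : A x -> 0 <= h x + inf Q * g x.
  move=> Ax; have [gx|gx] := ltP (g x) 0.
    have : inf Q <= h x / - g x by apply: ge_inf; [case: Q_inf|exists x].
    by rewrite ler_pdivlMr ?oppr_gt0//; lra.
  have [hx|hx] := leP 0 (h x); first by rewrite addr_ge0// mulr_ge0.
  have [gx0|gx0] := eqVneq (g x) 0.
    have := cross _ _ Aa0 ga0 Ax hx; rewrite gx0 mulr0; lra.
  have {gx0}gx : 0 < g x by rewrite lt_neqAle eq_sym gx0.
  have : - h x / g x <= inf Q.
    apply: lb_le_inf => // _ [a [Aa ga] <-].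
    by rewrite ler_pdivrMr//; exact: cross.
  rewrite ler_pdivrMr//; lra.
have mu1 : 0 < 1 + inf Q by lra.
exists (1 + inf Q)^-1.
  by rewrite invr_ge0 ltW//= invf_le1//; lra.
move=> x Ax.
have -> : (1 - (1 + inf Q)^-1) * g x + (1 + inf Q)^-1 * h x
    = (1 + inf Q)^-1 * (h x + inf Q * g x) by field; rewrite gt_eqF.
by rewrite mulr_ge0 ?key// invr_ge0 ltW.
Qed.

(** Where [g ord0] is negative, the other functions are never simultaneously
    negative, so by induction some convex combination of them is nonnegative
    there; the case of two functions, applied to [g ord0] and this combination,
    finishes.  Shrinking [A] in this way may empty it, so the statement has to
    hold for an empty [A], which is why there is at least one function. *)
Lemma convex_alternative (R : realType) (E : lmodType R) (m : nat) (A : set E)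
    (g : 'I_m.+1 -> E -> R) :
  convex_set A -> (forall i, convex_function A (g i)) ->
  (forall x, A x -> exists i, 0 <= g i x) ->
  exists2 c : 'I_m.+1 -> R, (forall i, 0 <= c i) /\ \sum_i c i = 1 &
    forall x, A x -> 0 <= \sum_i c i * g i x.
Proof.
elim: m A g => [|m IH] A g cA cg gA.
  exists (fun=> 1); first by split=> //; rewrite big_ord1.
  by move=> x /gA[i]; rewrite big_ord1 mul1r (ord1 i).
have [||x [Ax gx]|c [c0 c1] cgA] := IH [set x | A x /\ g ord0 x < 0]
    (fun j => g (lift ord0 j)).
- exact: convex_set_sublevel.
- move=> i t x y; rewrite !inE => -[Ax _] [Ay _].
  by apply: cg; rewrite inE.
- have [i] := gA _ Ax; case: (unliftP ord0 i) => [j ->|->]; first by exists j.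
  by rewrite leNgt gx.
have [|t /andP[t0 t1] tA] := @convex_alternative2 _ _ A (g ord0)
    (fun x => \sum_j c j * g (lift ord0 j) x) cA (cg _)
    (convex_function_sum c0 (fun j => cg (lift ord0 j))).
  by move=> x Ax gx; apply: cgA.
exists (fun i => if unlift ord0 i is Some j then t * c j else 1 - t).
  split.
    move=> i; case: (unlift _ i) => [j|]; last by rewrite subr_ge0.
    exact: mulr_ge0.
  rewrite big_ord_recl unlift_none.
  by under eq_bigr do rewrite liftK; rewrite -mulr_sumr c1 mulr1 subrK.
move=> x Ax; rewrite big_ord_recl unlift_none.
under eq_bigr do rewrite liftK -mulrA.
by rewrite -mulr_sumr tA.
Qed.

(** * Compactness of the simplex and continuity of the weighted sums *)

Lemma bounded_setP (R : realType) (V : normedModType R) (A : set V) :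
  bounded_set A <-> exists M : R, forall x, A x -> `|x| <= M.
Proof.
split=> [[M [Mr MA]]|[M MA]].
  by exists (M + 1); apply: MA; rewrite ltrDl.
by exists M; split=> [|N /ltW MN x /MA/le_trans]; [exact: num_real|apply].
Qed.

Lemma interior_orthant (R : realType) (m : nat) :
  (@orthant R m)° = [set v | forall i, 0 < v ord0 i].
Proof.
apply/seteqP; split=> [v /nbhs_ballP[e /= e0 ve] i|v v0].
  have : ball v e (v - const_mx (e / 2)).
    rewrite -ball_normE/= opprB addrC subrK /Num.Def.normr /= mx_normrE.
    apply/bigmax_ltP; split=> // -[j k] _ /=; rewrite mxE.
    by rewrite gtr0_norm ?divr_gt0//; lra.
  by move=> /ve /(_ i); rewrite !mxE; lra.
rewrite /interior /=.
suff : nbhs v [set w : 'rV[R]_m | forall i, 0 < w ord0 i].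
  by apply: filterS => w w0 i; exact/ltW.
apply: (@filter_forall _ _ (fun i (w : 'rV[R]_m) => 0 < w ord0 i) _ (nbhs_filter v)) => i.
exact: (cvgr_gt _ (@coord_continuous R 1 m ord0 i v) _ (v0 i)).
Qed.

Lemma compact_Delta (R : realType) (m : nat) : compact (@Delta R m).
Proof.
have bD : bounded_set (@Delta R m).
  apply/bounded_setP; exists 1 => xi [xi0 xi1] /=.
  rewrite /Num.Def.normr /= mx_normrE; apply/bigmax_leP; split=> // -[j k] _ /=.
  rewrite (ord1 j) ger0_norm// -xi1 (bigD1 k)//= lerDl.
  by apply: sumr_ge0 => i _.
apply: bounded_closed_compact => //.
have -> : @Delta R m = (\bigcap_i [set xi | 0 <= xi ord0 i]) `&`
    [set xi | \sum_(i < m) xi ord0 i = 1].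
  by apply/seteqP; split=> xi [xi0 xi1]; split=> // i *; exact: xi0.
apply: closedI.
  apply: closed_bigI => i _.
  apply: (@closed_comp _ _ (fun xi : 'rV[R]_m => xi ord0 i)) (@closed_ge R 0).
  by move=> xi _; exact: coord_continuous.
apply: (@closed_comp _ _ (fun xi : 'rV[R]_m => \sum_(i < m) xi ord0 i)) (@closed_eq R 1).
move=> xi _; apply: continuous_big => [|i _]; last exact: coord_continuous.
exact: add_continuous.
Qed.

Lemma cvg_weighted_sum (R : realType) (n m : nat) (K : set 'rV[R]_n)
    (f : 'rV[R]_n -> 'rV[R]_m) (xi : 'rV[R]_m) (x : 'rV[R]_n) :
  {within K, continuous f} -> K x ->
  weighted_sum f p.2 p.1 @[p --> (within K (nbhs x), nbhs xi)] -->
    weighted_sum f xi x.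
Proof.
move=> /subspace_continuousP cf Kx.
apply: cvg_big => [|i _]; first exact: add_continuous.
apply: cvgM.
  apply: (@cvg_comp _ _ _ snd (fun z : 'rV[R]_m => z ord0 i)); first exact: cvg_snd.
  exact: coord_continuous.
apply: (@cvg_comp _ _ _ fst (fun y => f y ord0 i)); first exact: cvg_fst.
apply: (@cvg_comp _ _ _ f (fun z : 'rV[R]_m => z ord0 i)); first exact: cf.
exact: coord_continuous.
Qed.

(** This is the form of joint continuity consumed by the compactness
    arguments: the neighbourhoods of the point and of the weight are chosen
    together, as the tube lemma requires. *)
Lemma near_weighted_sum_lt (R : realType) (n m : nat) (K : set 'rV[R]_n)
    (f : 'rV[R]_n -> 'rV[R]_m) (xi : 'rV[R]_m) (x y : 'rV[R]_n) :
  {within K, continuous f} -> K x ->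
  weighted_sum f xi y < weighted_sum f xi x ->
  \forall x' \near x & xi' \near xi,
    K x' -> weighted_sum f xi' y < weighted_sum f xi' x'.
Proof.
move=> cf Kx lt_yx.
have cy : continuous (fun z : 'rV[R]_m => weighted_sum f z y).
  apply: continuous_big => [|i _ z]; first exact: add_continuous.
  apply: (cvgMl (FF := nbhs_filter z)); exact: coord_continuous.
have cD : weighted_sum f p.2 p.1 - weighted_sum f p.2 y
    @[p --> (within K (nbhs x), nbhs xi)] -->
    weighted_sum f xi x - weighted_sum f xi y.
  apply: cvgB; first exact: cvg_weighted_sum.
  apply: (@cvg_comp _ _ _ snd (fun z => weighted_sum f z y)); last exact: cy.
  exact: cvg_snd.
have FF : Filter (filter_prod (within K (nbhs x)) (nbhs xi)) by exact: filter_prod_filter.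
have [|[P Q] /= [KP xiQ] PQ] := @cvgr_gt _ _ _ FF _ _ cD 0.
  by rewrite subr_gt0.
(* A neighbourhood within [K] is a neighbourhood once its membership condition
   is made conditional on [K]. *)
exists ([set x' | K x' -> P x'], Q) => //= -[x' xi'] /= [Px' Qxi'] Kx'.
by rewrite -subr_gt0; apply: (PQ (x', xi')); split=> //; exact: Px'.
Qed.

(** * Scalarization of weak Pareto solutions *)

Lemma SolwP (R : realType) (n m : nat) (K : set 'rV[R]_n)
    (f : 'rV[R]_n -> 'rV[R]_m) (x : 'rV[R]_n) :
  Solw K f x <->
  K x /\ forall y, K y -> exists i, f x ord0 i <= f y ord0 i.
Proof.
split=> -[Kx Sx]; split=> //.
- move=> y Ky; apply: contrapT => nle; apply: Sx; exists y => //.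
  exists (f x - f y); last by rewrite opprB.
  rewrite interior_orthant => i; rewrite !mxE subr_gt0 ltNge.
  by apply/negP => le; apply: nle; exists i.
- case=> y /Sx[i le_xy] [v]; rewrite interior_orthant => /(_ i) v0 /rowP/(_ i).
  rewrite !mxE; lra.
Qed.

(** Some weight is positive because the weights sum to 1, so a point better in
    every coordinate would have a strictly smaller weighted sum. *)
Lemma Theta1_sub_Solw (R : realType) (n m : nat) (K : set 'rV[R]_n)
    (f : 'rV[R]_n -> 'rV[R]_m) (xi : 'rV[R]_m) :
  Delta xi -> Theta1 K f xi `<=` Solw K f.
Proof.
move=> [xi0 xi1] x [Kx xmin]; apply/SolwP; split=> // y Ky.
have [i /andP[_ xii]] : exists i, (true && (0 < xi ord0 i)).
  apply: psumr_neq0P => [i _|]; first exact: xi0.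
  by rewrite xi1; apply/eqP; exact: oner_neq0.
apply: contrapT => nle.
have lt_yx j : f y ord0 j < f x ord0 j.
  by rewrite ltNge; apply/negP => le; apply: nle; exists j.
have := xmin y Ky; rewrite leNgt => /negP; apply.
rewrite /weighted_sum (bigD1 i)//= [ltRHS](bigD1 i)//=.
apply: ltr_leD; first by rewrite ltr_pM2l.
by apply: ler_sum => j _; apply: ler_wpM2l; [exact: xi0|exact: ltW].
Qed.

(** Weak Pareto optimality of [x] says that the convex functions
    [f_i - f_i x] are never simultaneously negative on [K].  There is at least
    one of them: with no objective every point vacuously improves on [x]. *)
Lemma Solw_Theta1 (R : realType) (n m : nat) (K : set 'rV[R]_n)
    (f : 'rV[R]_n -> 'rV[R]_m) (x : 'rV[R]_n) :
  convex_set K -> (forall i, convex_function K (fun x => f x ord0 i)) ->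
  Solw K f x -> exists2 xi, Delta xi & Theta1 K f xi x.
Proof.
case: m f => [|m] f cK cf /SolwP[Kx xK]; first by have [[]] := xK x Kx.
have [||c [c0 c1] cK0] := @convex_alternative _ _ m K
    (fun i y => f y ord0 i - f x ord0 i) cK.
- move=> i t y z yK zK; have := cf i t y z yK zK.
  rewrite !convRE /= /unstable.onem; lra.
- by move=> y /xK[i]; exists i; rewrite subr_ge0.
exists (\row_i c i).
  split=> [i|]; first by rewrite mxE.
  by under eq_bigr do rewrite mxE.
split=> // y Ky; rewrite -subr_ge0 /weighted_sum -sumrB.
by under eq_bigr do rewrite mxE -mulrBr; exact: cK0.
Qed.

(** * A closed domain bounds the weak Pareto set *)

Lemma convex_weighted_sum (R : realType) (n m : nat) (K : set 'rV[R]_n)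
    (f : 'rV[R]_n -> 'rV[R]_m) (xi : 'rV[R]_m) :
  (forall i, convex_function K (fun x => f x ord0 i)) ->
  Delta xi -> convex_function K (weighted_sum f xi).
Proof. by move=> cf [xi0 _]; exact: convex_function_sum. Qed.

(** A minimizer [x] outside the sphere of radius [r] is joined to [x0] by a
    segment that meets the sphere at a point of [K], where convexity bounds the
    weighted sum by its larger endpoint value, the one at [x0]. *)
Lemma Theta1_ball (R : realType) (n m : nat) (K : set 'rV[R]_n)
    (f : 'rV[R]_n -> 'rV[R]_m) (xi : 'rV[R]_m) (x0 : 'rV[R]_n) (r : R) :
  convex_set K -> (forall i, convex_function K (fun x => f x ord0 i)) ->
  Delta xi -> K x0 -> 0 < r ->
  (forall z, K z -> `|z - x0| = r ->
     weighted_sum f xi x0 < weighted_sum f xi z) ->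
  forall x, Theta1 K f xi x -> `|x - x0| <= r.
Proof.
move=> cK cf Dxi Kx0 r0 sphere x [Kx xmin].
rewrite leNgt; apply/negP => rx.
have d0 : 0 < `|x - x0| by exact: lt_trans rx.
pose t := r / `|x - x0|.
have t01 : 0 <= t <= 1.
  by rewrite divr_ge0 ?(ltW r0)//= ler_pdivrMr// mul1r ltW.
have := sphere _ (convex_set_comb cK Kx Kx0 t01).
have -> : t *: x + (1 - t) *: x0 - x0 = t *: (x - x0).
  by rewrite scalerBl scale1r scalerBr addrA addrAC addrK.
rewrite normrZ ger0_norm; last by case/andP: t01.
rewrite divfK ?gt_eqF// => /(_ erefl); rewrite ltNge => /negP; apply.
apply: le_trans (convex_function_comb (convex_weighted_sum cf Dxi) Kx Kx0 t01) _.
by have := xmin _ Kx0; case/andP: t01; nra.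
Qed.

(** Boundedness of the minimizers for one weight is detected on a compact
    sphere by a strict inequality, and therefore passes to nearby weights with a
    common bound. *)
Lemma near_Theta1_bounded (R : realType) (n m : nat) (K : set 'rV[R]_n)
    (f : 'rV[R]_n -> 'rV[R]_m) (xi : 'rV[R]_m) :
  closed K -> convex_set K -> {within K, continuous f} ->
  (forall i, convex_function K (fun x => f x ord0 i)) ->
  dom_Theta1 K f xi -> bounded_set (Theta1 K f xi) ->
  exists M : R, \forall xi' \near xi, Delta xi' ->
    forall x, Theta1 K f xi' x -> `|x| <= M.
Proof.
move=> clK cK fc cf [Dxi [x0 [Kx0 x0min]]] /bounded_setP[M Mxi].
(* Every [z] with [`|z| <= M] satisfies [`|z - x0| <= M + `|x0| < r], so the
   sphere of radius [r] contains no minimizer of [f_xi]. *)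
pose r := M + `|x0| + 1.
have M0 : 0 <= M by exact: le_trans (Mxi x0 _).
have r0 : 0 < r by rewrite /r; have := normr_ge0 x0; lra.
have cdist : continuous (fun z : 'rV[R]_n => `|z - x0|).
  move=> z; apply: (@cvg_comp _ _ _ (fun z => z - x0) (fun w : 'rV[R]_n => `|w|) _ (nbhs (z - x0))).
    by apply: (cvgB (FF := nbhs_filter z)); [exact: cvg_id|exact: cvg_cst].
  exact: norm_continuous.
pose S := K `&` [set z | `|z - x0| = r].
have cS : compact S.
  apply: bounded_closed_compact.
    apply/bounded_setP; exists (r + `|x0|) => z [_ /= <-].
    by rewrite -{1}(subrK x0 z) ler_normD.
  apply: closedI => //.
  apply: (@closed_comp _ _ (fun z : 'rV[R]_n => `|z - x0|)) (@closed_eq R r).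
  move=> z _; exact: cdist.
have Sxi z : S z -> weighted_sum f xi x0 < weighted_sum f xi z.
  move=> [Kz zr]; rewrite ltNge; apply/negP => le_zx0.
  have /Mxi zM : Theta1 K f xi z.
    by split=> // y Ky; exact: le_trans le_zx0 (x0min _ Ky).
  by have := ler_normB z x0; rewrite zr /r; lra.
exists (r + `|x0|).
move/compact_near_coveringP/near_covering_withinP : cS.
move=> /(_ _ (nbhs xi) (fun xi' z => weighted_sum f xi' x0 < weighted_sum f xi' z)).
move=> /(_ (nbhs_filter xi)) => near_S.
have {}near_S : \forall xi' \near xi, forall z, S z ->
    weighted_sum f xi' x0 < weighted_sum f xi' z.
  apply: near_S => z Sz.
  have := near_weighted_sum_lt fc (proj1 Sz) (Sxi _ Sz).
  by apply: filterS => -[z' xi'] /= lt_x0 [Kz' _]; exact: lt_x0.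
apply: filterS near_S => xi' S_lt Dxi' x Tx.
have := Theta1_ball cK cf Dxi' Kx0 r0 (fun z Kz zr => S_lt z (conj Kz zr)) Tx.
by rewrite -{2}(subrK x0 x) => ?; apply: le_trans (ler_normD _ _) _; rewrite lerD2r.
Qed.

Lemma bounded_Solw (R : realType) (n m : nat) (K : set 'rV[R]_n)
    (f : 'rV[R]_n -> 'rV[R]_m) :
  closed K -> convex_set K -> {within K, continuous f} ->
  (forall i, convex_function K (fun x => f x ord0 i)) ->
  (forall xi, dom_Theta1 K f xi -> bounded_set (Theta1 K f xi)) ->
  closed_in (@Delta R m) (dom_Theta1 K f) -> bounded_set (Solw K f).
Proof.
move=> clK cK fc cf bT /closed_subspaceP[V clV VD].
have cdom : compact (dom_Theta1 K f).
  have -> : dom_Theta1 K f = @Delta R m `&` V.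
    by rewrite setIC VD; apply/esym/setIidPl => xi [].
  apply: compact_closedI; last exact: clV.
  exact: compact_Delta.
move/compact_near_coveringP/near_covering_withinP : cdom.
move=> /(_ _ +oo (fun (M : R) xi => forall x, Theta1 K f xi x -> `|x| <= M)).
case=> [xi domxi|M [_ MP]].
  have [M near_M] := near_Theta1_bounded clK cK fc cf domxi (bT _ domxi).
  exists ([set xi' | Delta xi' -> forall x, Theta1 K f xi' x -> `|x| <= M],
          [set N | M <= N]) => /=.
    split; first exact: near_M.
    by apply: nbhs_pinfty_ge; exact: num_real.
  by move=> [xi' N] /= [xi'M MN] [Dxi' _] x /(xi'M Dxi')/le_trans; apply.
apply/bounded_setP; exists (M + 1) => x Sx.
have [xi Dxi Tx] := Solw_Theta1 cK cf Sx.
by apply: (MP (M + 1) _ xi) => //; [rewrite ltrDl|split=> //; exists x].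
Qed.

(** * A bounded weak Pareto set closes the domain *)

Lemma closed_dom_Theta1 (R : realType) (n m : nat) (K : set 'rV[R]_n)
    (f : 'rV[R]_n -> 'rV[R]_m) :
  closed K -> {within K, continuous f} ->
  bounded_set (Solw K f) -> closed_in (@Delta R m) (dom_Theta1 K f).
Proof.
move=> clK fc /bounded_setP[M SM].
apply/closed_subspaceP; exists (closure (dom_Theta1 K f)).
  exact: closed_closure.
apply/seteqP; split=> xi [domxi Dxi]; split=> //; last exact: subset_closure.
apply: contrapT => ndom.
pose B := K `&` [set x | `|x| <= M].
have cB : compact B.
  apply: bounded_closed_compact; first by apply/bounded_setP; exists M => x [].
  apply: closedI => //.
  apply: (@closed_comp _ _ (fun z : 'rV[R]_n => `|z|)) (@closed_le R M).
  by move=> z _; exact: norm_continuous.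
move/compact_near_coveringP/near_covering_withinP : cB.
move=> /(_ _ (nbhs xi) (fun xi' x => ~ Theta1 K f xi' x) (nbhs_filter xi)).
move=> near_B.
have {}near_B : \forall xi' \near xi, forall x, B x -> ~ Theta1 K f xi' x.
  apply: near_B => x [Kx _].
  have [y [Ky lt_yx]] : exists y, K y /\ weighted_sum f xi y < weighted_sum f xi x.
    apply: contrapT => nex; apply: ndom; split=> //; exists x; split=> // y Ky.
    by rewrite leNgt; apply/negP => lt_yx; apply: nex; exists y.
  have := near_weighted_sum_lt fc Kx lt_yx.
  apply: filterS => -[x' xi'] /= lt_y [Kx' _] [_ /(_ _ Ky)].
  by rewrite leNgt lt_y.
have [xi' [[Dxi' [x Tx]] xi'B]] := domxi _ near_B.
apply: (xi'B x) => //; split; first by case: Tx.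
exact/SM/(Theta1_sub_Solw Dxi').
Qed.

Theorem theorem6p3 (R : realType) (n m : nat) (K : set 'rV[R]_n)
    (f : 'rV[R]_n -> 'rV[R]_m)
    (K_neq0 : K !=set0) (K_closed : closed K) (K_convex : convex_set K)
    (f_cont : {within K, continuous f})
    (f_convex : forall i : 'I_m, convex_function K (fun x => f x ord0 i))
    (Theta1_bounded :
       forall xi, dom_Theta1 K f xi -> bounded_set (Theta1 K f xi)) :
  ~ bounded_set (Solw K f) <-> ~ closed_in (@Delta R m) (dom_Theta1 K f).
Proof.
suff E : bounded_set (Solw K f) <-> closed_in (@Delta R m) (dom_Theta1 K f).
  by rewrite E.
split; first exact: closed_dom_Theta1.
exact: bounded_Solw.
Qed.
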